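(* Let $G$ be a finite simple graph that is $\{\text{Chair}, P_4+K_1\}$-free. Then $\chi(G)\le 2\omega(G)-1$.
   Context: $\chi(G)$ is the chromatic number and $\omega(G)$ the clique number. The Chair (fork) is the graph on vertices $c,a,b,d,e$ with edges $ca,cb,cd,de$. $P_4+K_1$ denotes the join of the path $P_4$ with a single vertex (the gem): a path $p_1p_2p_3p_4$ plus a vertex adjacent to all of $p_1,\dots,p_4$. A graph is $\{H_1,\dots,H_k\}$-free if it has no induced subgraph isomorphic to any $H_i$. *)

(* Defs.v *)
From mathcomp Require Import all_boot.
Set Implicit Arguments.
Unset Strict Implicit.
Unset Printing Implicit Defensive.

Record sgraph := SGraph {
  svertex :> finType;
  sedge : rel svertex;
  sedge_sym : symmetric sedge;
  sedge_irrefl : irreflexive sedge }.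

Section Invariants.
Variable G : sgraph.

Definition clique (A : {set G}) : bool :=
  [forall x in A, forall y in A, (x != y) ==> sedge x y].

Definition clique_number : nat := \max_(A : {set G} | clique A) #|A|.

Definition proper_coloring k (f : {ffun G -> 'I_k}) : bool :=
  [forall x, forall y, sedge x y ==> (f x != f y)].

Definition colorable (k : nat) : bool :=
  [exists f : {ffun G -> 'I_k}, proper_coloring f].

Lemma colorable_exists : exists k, colorable k.
Proof.
exists #|G|; apply/existsP; exists [ffun x => enum_rank x].
apply/forallP => x; apply/forallP => y; apply/implyP => exy.
rewrite !ffunE (inj_eq enum_rank_inj).
by apply/eqP => xy; rewrite xy sedge_irrefl in exy.
Qed.

Definition chromatic_number : nat := ex_minn colorable_exists.

End Invariants.

Section Induced.
Variables (G : sgraph) (A : {set G}).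

Definition induced_edge : rel {x : G | x \in A} :=
  fun x y => sedge (val x) (val y).

Lemma induced_edge_sym : symmetric induced_edge.
Proof. by move=> x y; apply: sedge_sym. Qed.

Lemma induced_edge_irrefl : irreflexive induced_edge.
Proof. by move=> x; apply: sedge_irrefl. Qed.

Definition induced : sgraph := SGraph induced_edge_sym induced_edge_irrefl.

End Induced.

Definition isomorphic (G H : sgraph) : Prop :=
  exists2 f : G -> H, bijective f & forall x y, sedge (f x) (f y) = sedge x y.

Definition free (H G : sgraph) : Prop :=
  forall A : {set G}, ~ isomorphic (induced A) H.

Section Path.
Variable n : nat.

Definition path_edge : rel 'I_n := fun i j => (i.+1 == j) || (j.+1 == i).

Lemma path_edge_sym : symmetric path_edge.
Proof. by move=> i j; rewrite /path_edge orbC. Qed.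

Lemma path_edge_irrefl : irreflexive path_edge.
Proof. by move=> i; rewrite /path_edge orbb -addn1 -{2}[val i]addn0 eqn_add2l. Qed.

Definition path_graph : sgraph := SGraph path_edge_sym path_edge_irrefl.

End Path.

Section Complete.
Variable n : nat.

Definition complete_edge : rel 'I_n := fun i j => i != j.

Lemma complete_edge_sym : symmetric complete_edge.
Proof. by move=> i j; rewrite /complete_edge eq_sym. Qed.

Lemma complete_edge_irrefl : irreflexive complete_edge.
Proof. by move=> i; rewrite /complete_edge eqxx. Qed.

Definition complete_graph : sgraph :=
  SGraph complete_edge_sym complete_edge_irrefl.

End Complete.

Section Join.
Variables G H : sgraph.

Definition join_edge : rel (G + H)%type := fun u v =>
  match u, v with
  | inl x, inl y => sedge x y
  | inr x, inr y => sedge x y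
  | _, _ => true
  end.

Lemma join_edge_sym : symmetric join_edge.
Proof. by move=> [x|x] [y|y] //=; apply: sedge_sym. Qed.

Lemma join_edge_irrefl : irreflexive join_edge.
Proof. by move=> [x|x] /=; apply: sedge_irrefl. Qed.

Definition join_graph : sgraph := SGraph join_edge_sym join_edge_irrefl.

End Join.

(* Vertices c, a, b, d, e are numbered 0, 1, 2, 3, 4; edges ca, cb, cd, de. *)
Definition chair_edges : seq (nat * nat) := [:: (0, 1); (0, 2); (0, 3); (3, 4)].

Definition chair_edge : rel 'I_5 := fun i j =>
  ((val i, val j) \in chair_edges) || ((val j, val i) \in chair_edges).

Lemma chair_edge_sym : symmetric chair_edge.
Proof. by move=> i j; rewrite /chair_edge orbC. Qed.

Lemma chair_edge_irrefl : irreflexive chair_edge.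
Proof. by case; do 5?case=> //. Qed.

Definition Chair : sgraph := SGraph chair_edge_sym chair_edge_irrefl.

(* Here "+" is the join, not the disjoint union. *)
Definition P4_plus_K1 : sgraph := join_graph (path_graph 4) (complete_graph 1).

(* Main.v *)
(** A gem-free graph has P4-free, hence perfect, neighbourhoods. Let A be a
    minimal vertex set that is not (2w - 1)-colourable, w being the clique
    number. Every vertex of A has degree at least 2w - 1 in A, so its perfect
    neighbourhood, without w-cliques, contains a stable triple: every vertex is
    the centre of a claw. Inspecting how vertices attach to an induced C5 shows
    that its five vertices cannot all be claw centres, so A has no induced C5.
    Take v in A and a stable S in N(v) with |S| >= 3 maximum over all choices.
    By chair-freeness, and by maximality together with the absence of
    homogeneous nonclique sets in A, each vertex at distance 2 from v misses at
    most one vertex of S. Hence the second layer L2 is P4-free, and each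
    component of the third layer L3 lies in the neighbourhood of a vertex of L2,
    without a fourth layer. So L1 + L3 takes w - 1 colours and {v} + L2 takes w. *)

Require Import Defs.
From mathcomp Require Import all_boot.

Set Implicit Arguments.
Unset Strict Implicit.
Unset Printing Implicit Defensive.

Local Notation "x -- y" := (sedge x y) (at level 30, no associativity).

(** * Forbidden induced subgraphs as edge patterns *)

Lemma free_embedding (H G : sgraph) (h : H -> G) :
  free H G -> injective h -> (forall x y, h x -- h y = x -- y) -> False.
Proof.
move=> freeHG h_inj hE; apply: (freeHG (h @: [set: H])).
pose g (x : H) : {x | x \in h @: [set: H]} :=
  exist _ (h x) (imset_f h (in_setT x)).
have g_inj : injective g by move=> x y /(congr1 val) /h_inj.
have [|f gK fK] := inj_card_bij g_inj.
  by rewrite card_sig card_imset // cardsT.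
exists f; first by exists g.
by move=> x y; rewrite -hE -{2}(fK x) -{2}(fK y).
Qed.

Section Patterns.
Variable G : sgraph.
Implicit Types (a b c d x y z p q v w : G).

Lemma edgeC x y : x -- y = y -- x. Proof. exact: sedge_sym. Qed.
Lemma edgexx x : x -- x = false. Proof. exact: sedge_irrefl. Qed.

Lemma sep_neq z x y : z -- x -> ~~ (z -- y) -> x != y.
Proof. by move=> zx; apply: contraNneq => <-. Qed.

(** Here [c] is the centre, [a] and [b] are leaves and [d x] is the long arm. Only the two leaves
    have the same neighbours in the chair, so every other pair is kept distinct by the edge pattern
    itself. *)
Lemma chair_freeP c a b d x : free Chair G -> a != b ->
  ~~ [&& c -- a, c -- b, c -- d, d -- x, ~~ (a -- b), ~~ (a -- d),
         ~~ (b -- d), ~~ (a -- x), ~~ (b -- x) & ~~ (c -- x)].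
Proof.
move=> freeC nab; apply/negP=> /and5P[ca cb cd dx].
case/and5P=> /negPf ab /negPf ad /negPf bd /negPf ax /andP[/negPf bx /negPf cx].
pose h (i : Chair) := nth c [:: c; a; b; d; x] i.
have hE i j : h i -- h j = i -- j.
  case: i => -[|[|[|[|[|//]]]]] ?; case: j => -[|[|[|[|[|//]]]]] ?;
  by rewrite /h /= ?edgexx ?ca ?cb ?cd ?dx ?ab ?ad ?bd ?ax ?bx ?cx // edgeC
     ?ca ?cb ?cd ?dx ?ab ?ad ?bd ?ax ?bx ?cx.
apply: (@free_embedding _ _ h freeC) => // i j hij.
have hN k : i -- k = j -- k by rewrite -!hE hij.
move: hij hN; case: i => -[|[|[|[|[|//]]]]] ?;
  case: j => -[|[|[|[|[|//]]]]] ? hij hN;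
  try by [apply: val_inj | move: (hN ord0) | move: (hN (@Ordinal 5 1 isT))
   | move: (hN (@Ordinal 5 3 isT)) | move: (hN (@Ordinal 5 4 isT))].
- by move: nab; rewrite [a]hij eqxx.
- by move: nab; rewrite [b]hij eqxx.
Qed.

(** No two vertices of the gem have the same neighbours, so the edge pattern alone makes the five
    vertices distinct. *)
Lemma gem_freeP v a b c d : free P4_plus_K1 G ->
  ~~ [&& v -- a, v -- b, v -- c, v -- d, a -- b, b -- c, c -- d,
         ~~ (a -- c), ~~ (a -- d) & ~~ (b -- d)].
Proof.
move=> freeC; apply/negP=> /and5P[va vb vc vd].
case/and5P=> ab bc cd /negPf ac /andP[/negPf ad /negPf bd].
pose h (i : P4_plus_K1) :=
  match i with inl k => nth v [:: a; b; c; d] k | inr _ => v end.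
have hE i j : h i -- h j = i -- j.
  case: i => [[[|[|[|[|//]]]] ?]|[[|//] ?]];
  case: j => [[[|[|[|[|//]]]] ?]|[[|//] ?]];
  by rewrite /h /= ?edgexx ?va ?vb ?vc ?vd ?ab ?bc ?cd ?ac ?ad ?bd // edgeC
     ?va ?vb ?vc ?vd ?ab ?bc ?cd ?ac ?ad ?bd.
apply: (@free_embedding _ _ h freeC) => // i j hij.
have hN k : i -- k = j -- k by rewrite -!hE hij.
move: hN {hij}; case: i => [[[|[|[|[|//]]]] ?]|[[|//] ?]];
  case: j => [[[|[|[|[|//]]]] ?]|[[|//] ?]] hN;
  try by [congr inl; apply: val_inj | congr inr; apply: val_inj
   | move: (hN (inr ord0)) | move: (hN (inl ord0))
   | move: (hN (inl (@Ordinal 4 1 isT))) | move: (hN (inl (@Ordinal 4 2 isT)))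
   | move: (hN (inl (@Ordinal 4 3 isT)))].
Qed.

End Patterns.

(** * Colourings and critical sets *)

Section Colorings.
Variable G : sgraph.
Implicit Types (x y v : G) (A B I K Q S : {set G}) (k w : nat).

Lemma cliqueP A :
  reflect {in A &, forall x y, x != y -> x -- y} (clique A).
Proof.
apply: (iffP forall_inP) => [cA x y xA yA | cA x xA].
  by move/forall_inP: (cA x xA) => /(_ y yA) /implyP.
by apply/forall_inP => y yA; apply/implyP; apply: cA.
Qed.

Lemma clique1 x : clique [set x].
Proof. by apply/cliqueP => y z /set1P-> /set1P->; rewrite eqxx. Qed.

Definition stable S := [forall x in S, forall y in S, ~~ (x -- y)].

Lemma stableP S : reflect {in S &, forall x y, ~~ (x -- y)} (stable S).
Proof.
apply: (iffP forall_inP) => [sS x y xS yS | sS x xS].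
  by move/forall_inP: (sS x xS) => /(_ y yS).
by apply/forall_inP => y yS; apply: sS.
Qed.

Lemma stableU1 x S : stable S -> {in S, forall y, ~~ (x -- y)} ->
  stable (x |: S).
Proof.
move=> /stableP sS xS; apply/stableP => y z /setU1P[->|yS] /setU1P[->|zS].
- by rewrite edgexx.
- exact: xS.
- by rewrite edgeC xS.
- exact: sS.
Qed.

Lemma cliqueU1 x K : clique K -> {in K, forall y, x -- y} -> clique (x |: K).
Proof.
move=> /cliqueP cK xK; apply/cliqueP => y z /setU1P[->|yS] /setU1P[->|zS].
- by rewrite eqxx.
- by move=> _; apply: xK.
- by rewrite edgeC => _; apply: xK.
- exact: cK.
Qed.

Definition clique_bound w A :=
  forall K, K \subset A -> clique K -> #|K| <= w.

Definition P4_free A := forall a b c d,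
  a \in A -> b \in A -> c \in A -> d \in A ->
  ~~ [&& a -- b, b -- c, c -- d, ~~ (a -- c), ~~ (a -- d) & ~~ (b -- d)].

Lemma P4_freeS A B : A \subset B -> P4_free B -> P4_free A.
Proof. by move=> /subsetP sAB fB a b c d /sAB ? /sAB ? /sAB ? /sAB ?; apply: fB. Qed.

Lemma clique_boundS w A B :
  A \subset B -> clique_bound w B -> clique_bound w A.
Proof. by move=> sAB bB K sKA; apply/bB/(subset_trans sKA). Qed.

(** The codomain has one spare colour, so that it is inhabited even when [k] is 0; vertices outside
    [A] may use it. *)
Definition colorable_on A k := [exists f : {ffun G -> 'I_k.+1},
  [forall x in A, f x < k] &&
  [forall x in A, forall y in A, x -- y ==> (f x != f y)]].

Definition coloring_on A k (f : G -> nat) :=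
  {in A, forall x, f x < k} /\ {in A &, forall x y, x -- y -> f x != f y}.

Lemma colorable_onP A k :
  reflect (exists f, coloring_on A k f) (colorable_on A k).
Proof.
apply: (iffP existsP) => [[f /andP[/forall_inP fk /forall_inP fA]] | [f [fk fA]]].
  exists (fun x => f x : nat); split=> // x y xA yA.
  by move/forall_inP: (fA x xA) => /(_ y yA) /implyP.
have fE x : x \in A -> @inord k (f x) = f x :> nat.
  by move=> /fk /ltnW fx; rewrite inordK.
exists [ffun x => inord (f x)]; apply/andP; split; apply/forall_inP => x xA.
  by rewrite ffunE fE ?fk.
apply/forall_inP => y yA; apply/implyP => xy.
by rewrite !ffunE -val_eqE /= !fE ?fA.
Qed.

Lemma colorable_on0 A k : A = set0 -> colorable_on A k.
Proof.
by move=> ->; apply/colorable_onP; exists (fun=> 0); split=> x; rewrite inE.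
Qed.

Lemma colorable_onU A B i j : colorable_on A i -> colorable_on B j ->
  colorable_on (A :|: B) (i + j).
Proof.
move=> /colorable_onP[f [fi fA]] /colorable_onP[g [gj gB]].
apply/colorable_onP; exists (fun x => if x \in A then f x else i + g x).
split=> [x|x y]; rewrite !inE.
  by case: ifP => [/fi fx _ | _ /gj gx]; rewrite ?ltn_add2l ?ltn_addr.
have neq_low u v : u \in A -> f u != i + g v.
  by move=> /fi fu; rewrite neq_ltn ltn_addr.
case: ifP => xA; case: ifP => yA //= xB yB xy; first exact: fA.
- exact: neq_low.
- by rewrite eq_sym neq_low.
- by rewrite eqn_add2l gB.
Qed.

Lemma colorable_onU_sep A B k : colorable_on A k -> colorable_on B k ->
  {in A & B, forall x y, ~~ (x -- y)} -> colorable_on (A :|: B) k.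
Proof.
move=> /colorable_onP[f [fk fA]] /colorable_onP[g [gk gB]] sep.
apply/colorable_onP; exists (fun x => if x \in A then f x else g x).
split=> [x|x y]; rewrite !inE; first by case: ifP => [/fk | _ /gk].
case: ifP => xA; case: ifP => yA //= xB yB; first exact: fA.
- by move=> xy; have := sep x y xA yB; rewrite xy.
- by rewrite edgeC => xy; have := sep y x yA xB; rewrite xy.
- exact: gB.
Qed.

(** * Perfection of P4-free sets *)

Lemma maximal_stable A : exists I, [/\ I \subset A, stable I &
  forall x, x \in A -> x \notin I -> exists2 y, y \in I & y -- x].
Proof.
have P0 : (set0 \subset A) && stable set0.
  by rewrite sub0set; apply/stableP => x; rewrite inE.
case: (@arg_maxnP _ set0 (fun I => (I \subset A) && stable I) (fun I => #|I|) P0).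
move=> I /andP[sIA sI] maxI; exists I; split=> // x xA xI.
apply/exists_inP; apply: contraLR (ltnSn #|I|) => /exists_inPn nI.
have := maxI (x |: I); rewrite cardsU1 xI -leqNgt; apply.
rewrite subUset sub1set xA sIA; apply: stableU1 => // y /nI.
by rewrite edgeC.
Qed.

(* Take [i] in the stable set with the most neighbours in [K]: a non-neighbour
   [x] of [i] in [K] has a neighbour [j] in the stable set, and if [j] misses a
   neighbour [y] of [i], then [i y x j] is an induced path. *)
Lemma P4_free_stable_clique A I K : P4_free A -> I \subset A -> stable I ->
  (forall x, x \in A -> x \notin I -> exists2 y, y \in I & y -- x) ->
  A != set0 -> K \subset A -> clique K -> [disjoint K & I] ->
  exists2 i, i \in I & {in K, forall x, i -- x}.
Proof.
move=> fA /subsetP sIA /stableP sI maxI /set0Pn[a aA] /subsetP sKA /cliqueP cK dKI.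
have [i0 i0I] : exists i, i \in I.
  have [aI|aI] := boolP (a \in I); first by exists a.
  by have [i iI _] := maxI a aA aI; exists i.
case: (@arg_maxnP _ i0 (mem I) (fun i => #|[set y in K | i -- y]|) i0I) => i iI maxi.
exists i => // x xK; apply: contraT => nix.
have xI := disjointFr dKI xK; have [j jI jx] := maxI x (sKA x xK) (negbT xI).
suff /proper_card lt_ij : [set y in K | i -- y] \proper [set y in K | j -- y].
  by have := maxi j jI; rewrite /= leqNgt lt_ij.
rewrite properE; apply/andP; split; last first.
  by apply/subsetPn; exists x; rewrite !inE xK ?jx.
apply/subsetP => y; rewrite !inE => /andP[yK iy]; rewrite yK /=.
have yx : y -- x by apply: cK => //; apply: sep_neq iy nix.
apply: contraT => njy.
have := fA i y x j (sIA _ iI) (sKA _ yK) (sKA _ xK) (sIA _ jI).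
by rewrite iy yx edgeC jx nix sI //= edgeC njy.
Qed.

(** Each colour class is a maximal stable set: a clique avoiding it extends by one of its vertices,
    so deleting it lowers the clique bound by one. *)
Lemma P4_free_colorable w A : P4_free A -> clique_bound w A -> colorable_on A w.
Proof.
elim: w A => [|w IHw] A fA bA.
  apply: colorable_on0; apply/eqP; apply: contraT => /set0Pn[x xA].
  by have := bA [set x]; rewrite sub1set cards1 ltnn clique1 => /(_ xA isT).
have [-> | A0] := eqVneq A set0; first exact: colorable_on0.
have [I [sIA sI maxI]] := maximal_stable A.
have colI : colorable_on I 1.
  apply/colorable_onP; exists (fun=> 0); split=> // x y xI yI.
  by move/stableP: sI => /(_ x y xI yI)/negPf->.
rewrite -(setID A I) (setIidPr sIA) -add1n; apply: colorable_onU => //.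
apply: IHw; first exact: P4_freeS (subsetDl _ _) fA.
move=> K; rewrite subsetD => /andP[sKA dKI] cK.
have [i iI iK] := P4_free_stable_clique fA sIA sI maxI A0 sKA cK dKI.
have iNK : i \notin K by rewrite (disjointFl dKI).
have := bA (i |: K); rewrite cardsU1 iNK add1n ltnS; apply.
  by rewrite subUset sub1set (subsetP sIA).
exact: cliqueU1.
Qed.

Definition nbhd A v := [set x in A | v -- x].

Lemma nbhd_P4_free A v : free P4_plus_K1 G -> P4_free (nbhd A v).
Proof.
move=> gem a b c d; rewrite !inE => /andP[_ va] /andP[_ vb] /andP[_ vc] /andP[_ vd].
by have := gem_freeP v a b c d gem; rewrite va vb vc vd.
Qed.

Lemma clique_bound_nbhd w v A : clique_bound w [set: G] ->
  {in A, forall x, v -- x} -> clique_bound w.-1 A.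
Proof.
move=> bw vA K /subsetP sKA cK.
have vK : v \notin K by apply/negP => /sKA/vA; rewrite edgexx.
have := bw (v |: K) (subsetT _); rewrite cardsU1 vK add1n.
by move=> /(_ (cliqueU1 cK (fun y yK => vA y (sKA y yK)))); case: w {bw}.
Qed.

(** * Minimal non-colourable sets *)

Definition critical A k := minset (fun B => ~~ colorable_on B k) A.

Lemma critical_proper A B k : critical A k -> B \proper A -> colorable_on B k.
Proof.
move=> /minsetP[_ minA] pBA; apply: contraT => /minA /(_ (proper_sub pBA)) BA.
by rewrite BA properxx in pBA.
Qed.

Lemma critical_not_colorable A k : critical A k -> colorable_on A k = false.
Proof. by case/minsetP => /negPf. Qed.

(* Replacing [Q] by a maximum clique of [Q] does not change the chromatic
   number, as [Q] is perfect. *)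
Lemma critical_homogeneous A Q k : critical A k -> Q \subset A -> P4_free Q ->
  (forall u, u \in A -> u \notin Q -> {in Q &, forall x y, u -- x -> u -- y}) ->
  clique Q.
Proof.
move=> critA sQA fQ homQ.
have P0 : (set0 \subset Q) && clique (set0 : {set G}).
  by rewrite sub0set; apply/cliqueP => x; rewrite inE.
case: (@arg_maxnP _ set0 (fun I => (I \subset Q) && clique I) (fun I => #|I|) P0).
move=> K /andP[sKQ cK] maxK.
have [<- //|nKQ] := eqVneq K Q.
have bQ : clique_bound #|K| Q by move=> L sLQ cL; apply: maxK; rewrite sLQ.
have [g [gk gQ]] := colorable_onP _ _ (P4_free_colorable fQ bQ).
have pA : A :\: (Q :\: K) \proper A.
  have /properP[_ [x xQ xK]] : K \proper Q by rewrite properEneq nKQ.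
  apply/properP; split; first exact: subsetDl.
  by exists x; rewrite ?(subsetP sQA) // !inE xQ xK.
have [f [fk fA]] := colorable_onP _ _ (critical_proper critA pA).
(* [r] folds [Q] onto [K], sending a vertex to the clique vertex indexed by its colour. Edges go to
   edges, so the colouring [f] of the smaller set pulls back to [A]. *)
pose r x := if x \in Q then nth x (enum K) (g x) else x.
have rK x : x \in Q -> r x \in K.
  by move=> xQ; rewrite /r xQ -mem_enum mem_nth // -cardE gk.
have rA x : x \in A -> r x \in A :\: (Q :\: K).
  rewrite !inE negb_and negbK => xA; have [xQ|xQ] := boolP (x \in Q).
    by rewrite rK // (subsetP sQA) // (subsetP sKQ) // rK.
  by rewrite /r (negPf xQ) xQ orbT.
have half x y : x \in A -> x \notin Q -> y \in Q -> x -- y -> r x -- r y.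
  move=> xA xQ yQ xy; rewrite {1}/r (negPf xQ).
  by apply: homQ xy => //; apply: (subsetP sKQ); apply: rK.
case/negP: (negbT (critical_not_colorable critA)).
apply/colorable_onP; exists (f \o r); split=> [x xA | x y xA yA xy] /=.
  by apply: fk; apply: rA.
apply: fA; rewrite ?rA //.
have [xQ|xQ] := boolP (x \in Q); have [yQ|yQ] := boolP (y \in Q).
- apply: (cliqueP _ cK); rewrite ?rK //.
  rewrite /r xQ yQ (set_nth_default x) -?cardE ?gk //.
  by rewrite nth_uniq -?cardE ?gk ?enum_uniq ?gQ.
- by rewrite edgeC half // edgeC.
- exact: half.
- by rewrite /r (negPf xQ) (negPf yQ).
Qed.

Lemma card_fibers_le A n m (f : G -> nat) : {in A, forall x, f x < n} ->
  (forall i, #|[set x in A | f x == i]| <= m) -> #|A| <= m * n.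
Proof.
elim: n A => [|n IHn] A fn fm.
  by rewrite muln0 leqn0 cards_eq0; apply/set0Pn => -[x /fn].
rewrite -(cardsID [set x | f x == n] A) mulnS leq_add //.
  by apply: leq_trans (fm n); apply: subset_leq_card; apply/subsetP => x; rewrite !inE.
apply: IHn => [x|i].
  by rewrite !inE => /andP[xn /fn]; rewrite ltnS leq_eqVlt (negPf xn).
apply: leq_trans (fm i); apply: subset_leq_card; apply/subsetP => x.
by rewrite !inE => /andP[/andP[_ ->]].
Qed.

Lemma missed_color A k (f : G -> nat) : #|A| < k ->
  exists2 c, c < k & {in A, forall x, f x != c}.
Proof.
case: k => // k ltAk.
have /subsetPn[c _ cA] :
    ~~ ([set: 'I_k.+1] \subset [set inord (f x) | x in A]).
  apply: contraL ltAk => /subset_leq_card; rewrite cardsT card_ord -leqNgt.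
  by move/leq_trans; apply; apply: leq_imset_card.
exists c => // x xA; apply: contraNneq cA => fxc; apply/imsetP; exists x => //.
by apply: val_inj; rewrite /= fxc inordK.
Qed.

(** Without a stable triple in the neighbourhood of [v], each of its [w.-1] colour classes has at
    most two vertices, so [v] has degree below [2 * w - 1]. A colouring of the rest of [A], which
    criticality provides, then extends to [v]. *)
Lemma critical_claw A v w : free P4_plus_K1 G -> clique_bound w [set: G] ->
  critical A (2 * w - 1) -> v \in A ->
  exists S, [/\ S \subset nbhd A v, stable S & 3 <= #|S|].
Proof.
move=> gem bw critA vA.
suff /existsP[S /and3P[]] :
    [exists S : {set G}, [&& S \subset nbhd A v, stable S & 3 <= #|S|]].
  by exists S.
apply: contraT => /existsPn noS.
have alpha2 S : S \subset nbhd A v -> stable S -> #|S| <= 2.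
  by move=> sSN sS; have := noS S; rewrite sSN sS -leqNgt.
have w_gt0 : 0 < w.
  by have := bw [set v] (subsetT _) (clique1 v); rewrite cards1.
have bN : clique_bound w.-1 (nbhd A v).
  by apply: (@clique_bound_nbhd _ v) => // x; rewrite inE => /andP[].
have [f [fk fN]] :=
  colorable_onP _ _ (P4_free_colorable (@nbhd_P4_free A v gem) bN).
have ltN : #|nbhd A v| < 2 * w - 1.
  have: #|nbhd A v| <= 2 * w.-1.
    apply: card_fibers_le fk _ => i; apply: alpha2.
      by apply/subsetP => x; rewrite inE => /andP[].
    apply/stableP => x y; rewrite !inE => /andP[xN /eqP fx] /andP[yN /eqP fy].
    by apply/negP => /fN; rewrite !inE fx fy eqxx => /(_ xN yN).
  by case: w w_gt0 {bw critA bN fk} => // w _ /=; rewrite mulnS subn1.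
have [g [gk gA]] := colorable_onP _ _ (critical_proper critA (properD1 vA)).
have [c ck cN] := missed_color g ltN.
case/negP: (negbT (critical_not_colorable critA)).
apply/colorable_onP; exists (fun x => if x == v then c else g x).
split=> [x xA | x y xA yA]; first by case: eqP => // /eqP xv; rewrite gk // !inE xv.
case: (eqVneq x v) => [->|xv]; case: (eqVneq y v) => [->|yv] xy.
- by rewrite edgexx in xy.
- by rewrite eq_sym cN // inE yA.
- by rewrite cN // inE xA edgeC.
- by rewrite gA // !inE ?xv ?yv.
Qed.

End Colorings.

(** * Induced pentagons *)

Ltac decide_edges :=
  repeat (match goal with |- context [sedge ?x ?y] => case: (sedge x y) => //= end).

(** Gives each pair of vertices a single orientation, so that one case split settles both forms of
    an edge. *)
Ltac orient x y := rewrite ?(edgeC y x).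

Ltac orient_pentagon a b c d e :=
  orient a b; orient a c; orient a d; orient a e; orient b c; orient b d;
  orient b e; orient c d; orient c e; orient d e.

Ltac orient_from y a b c d e :=
  orient y a; orient y b; orient y c; orient y d; orient y e.

Section Pentagon.
Variable G : sgraph.
Hypotheses (chairF : free Chair G) (gemF : free P4_plus_K1 G).
Implicit Types (a b c d e p q t x y z v : G).

Definition pentagon a b c d e :=
  [&& a -- b, b -- c, c -- d, d -- e, e -- a,
      ~~ (a -- c), ~~ (b -- d), ~~ (c -- e), ~~ (d -- a) & ~~ (e -- b)].

Definition claw v := exists x y z,
  [/\ v -- x, v -- y & v -- z] /\ [/\ x != y, x != z & y != z] /\
  [/\ ~~ (x -- y), ~~ (x -- z) & ~~ (y -- z)].

Lemma pentagon_rot a b c d e : pentagon a b c d e -> pentagon b c d e a.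
Proof.
by rewrite /pentagon; do 9![case/andP=> ?]; move=> ?; do ?[apply/andP; split].
Qed.

Lemma pentagon_rev a b c d e : pentagon a b c d e -> pentagon a e d c b.
Proof.
rewrite /pentagon (edgeC e a) (edgeC d a) (edgeC e b) (edgeC a b) (edgeC b c).
rewrite (edgeC c d) (edgeC d e) (edgeC a c) (edgeC b d) (edgeC c e).
by do 9![case/andP=> ?]; move=> ?; do ?[apply/andP; split].
Qed.

(* Up to rotation and reflection, a vertex outside the pentagon [a b c d e] that
   is adjacent to it sees two consecutive vertices, three consecutive vertices,
   or a vertex and the opposite edge, as in [opp_type]. *)
Definition opp_type a b c d e y :=
  [&& y -- a, y -- c, y -- d, ~~ (y -- b) & ~~ (y -- e)].

(** The neighbours on the pentagon are [a], [b] and at most one of [c], [d]; with [d] the vertex has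
    opposite type at [d]. *)
Definition left_type a b c d e y :=
  [&& y -- a, y -- b, ~~ (y -- e) & ~~ ((y -- c) && (y -- d))].

Definition clone_type a b c d e y :=
  [&& y -- a, y -- b, y -- e, ~~ (y -- c) & ~~ (y -- d)].

(** Off the pentagon, [y] has at most three neighbours on it, or a gem is centred at [y]; and [y]
    sees [b], or [e], or both [c] and [d], or a chair is centred at [a]. *)
Lemma nbr_type a b c d e y : pentagon a b c d e -> a -- y ->
  [\/ opp_type a b c d e y, (y == b) || left_type a b c d e y,
      (y == e) || left_type a e d c b y | clone_type a b c d e y].
Proof.
move=> P ay.
have [yb|yb] := eqVneq y b; first by constructor 2.
have [ye|ye] := eqVneq y e; first by constructor 3.
rewrite /=; apply/or4P; move: P; rewrite /pentagon /opp_type /left_type /clone_type.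
have := @chair_freeP G a y e b c chairF ye; have := @chair_freeP G a y b e d chairF yb.
have := @gem_freeP G y a b c d gemF; have := @gem_freeP G y b c d e gemF.
have := @gem_freeP G y c d e a gemF; have := @gem_freeP G y d e a b gemF.
have := @gem_freeP G y e a b c gemF.
move: ay; orient_pentagon a b c d e; orient_from y a b c d e.
by decide_edges.
Qed.

(** In a pentagon, [y] and [p] form a claw at [a] with [e], and a claw at [b] with [c]. *)
Definition opp_edge_pair a b c d e := exists y p,
  [/\ opp_type d e a b c y, [&& p -- a, p -- b, ~~ (p -- c) & ~~ (p -- e)],
      ~~ (y -- p) & y != p].

(** Excluding the chair at [a] with leaves [x], [y] and arm [e d] makes one of them see [d];
    excluding a chair at [d] then keeps the other from seeing [c]. *)
Lemma left_type_pair a b c d e x y : pentagon a b c d e ->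
  left_type a b c d e x -> left_type a b c d e y -> x != y -> ~~ (x -- y) ->
  opp_edge_pair a b c d e.
Proof.
move=> P lx ly nxy xy.
have ne z : left_type a b c d e z -> z != e.
  by apply: contraTneq => ->; move: P; rewrite /pentagon /left_type; decide_edges.
suff [] : opp_type d e a b c x /\ ~~ (y -- c) \/ opp_type d e a b c y /\ ~~ (x -- c).
- move=> [ox yc]; exists x, y; split=> //.
  by move: ly; rewrite /left_type (negPf yc) => /and4P[-> -> -> _].
- move=> [oy xc]; exists y, x; rewrite (edgeC y x) (eq_sym y x); split=> //.
  by move: lx; rewrite /left_type (negPf xc) => /and4P[-> -> -> _].
suff: opp_type d e a b c x && ~~ (y -- c) || opp_type d e a b c y && ~~ (x -- c).
  by case/orP => /andP[]; [left | right].
have := @chair_freeP G a x y e d chairF nxy.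
have := @chair_freeP G b x y c d chairF nxy.
have := @chair_freeP G d x e c y chairF (ne x lx).
have := @chair_freeP G d y e c x chairF (ne y ly).
move: P lx ly xy; rewrite /pentagon /left_type /opp_type.
orient_pentagon a b c d e; orient_from x a b c d e; orient_from y a b c d e.
orient x y; by decide_edges.
Qed.

(** If [y] saw exactly one of [b] and [e], there would be a gem centred at [a]; if both, [x] and [y]
    would be leaves of a chair at [b] with arm [c d]. *)
Lemma clone_type_adj a b c d e x y : pentagon a b c d e ->
  clone_type a b c d e x -> x != y -> a -- y -> ~~ (x -- y) ->
  opp_type a b c d e y.
Proof.
move=> P tx nxy ay xy.
have := @chair_freeP G b x y c d chairF nxy.
have := @gem_freeP G a y b x e gemF; have := @gem_freeP G a y e x b gemF.
have tyP : [|| opp_type a b c d e y, (y == b) || left_type a b c d e y,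
      (y == e) || left_type a e d c b y | clone_type a b c d e y].
  exact/or4P/(nbr_type P ay).
have yb : y != b.
  by apply: contraNneq xy => ->; move: tx; rewrite /clone_type; decide_edges.
have ye : y != e.
  by apply: contraNneq xy => ->; move: tx; rewrite /clone_type; decide_edges.
move: P ay tx xy tyP; rewrite (negPf yb) (negPf ye).
rewrite /pentagon /left_type /opp_type /clone_type.
orient_pentagon a b c d e; orient_from x a b c d e; orient_from y a b c d e.
orient x y; by decide_edges.
Qed.

(** If a claw leaf has opposite type or is a clone of [a], an opposite vertex exists. Otherwise two
    of the three leaves lie on the same side of [a], and [left_type_pair] applies to them, directly
    or after reflection. *)
Lemma claw_pentagon a b c d e : pentagon a b c d e -> claw a ->
  [\/ exists y, opp_type a b c d e y, opp_edge_pair a b c d e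
    | opp_edge_pair a e d c b].
Proof.
move=> P [x [y [z [[ax ay az] [[nxy nxz nyz] [xy xz yz]]]]]].
have side u v : a -- u -> a -- v -> u != v -> ~~ (u -- v) ->
    (exists y, opp_type a b c d e y) \/
    ((u == b) || left_type a b c d e u) \/ ((u == e) || left_type a e d c b u).
  move=> au av nuv uv; case: (nbr_type P au) => h; try by [left; exists u | right; auto].
  by left; exists v; apply: clone_type_adj uv.
have lefts u v : (u == b) || left_type a b c d e u ->
    (v == b) || left_type a b c d e v -> u != v -> ~~ (u -- v) ->
    opp_edge_pair a b c d e.
  case/predU1P=> [->|lu] /predU1P[->|lv] nuv; first by rewrite eqxx in nuv.
  - by rewrite edgeC; case/and4P: lv => _ ->.
  - by case/and4P: lu => _ ->.
  - exact: left_type_pair.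
have rights u v : (u == e) || left_type a e d c b u ->
    (v == e) || left_type a e d c b v -> u != v -> ~~ (u -- v) ->
    opp_edge_pair a e d c b.
  case/predU1P=> [->|lu] /predU1P[->|lv] nuv; first by rewrite eqxx in nuv.
  - by rewrite edgeC; case/and4P: lv => _ ->.
  - by case/and4P: lu => _ ->.
  - by apply: left_type_pair (pentagon_rev P) lu lv nuv.
have [|sx] := side x y ax ay nxy xy; first by constructor 1.
have [|sy] := side y z ay az nyz yz; first by constructor 1.
have zx : ~~ (z -- x) by rewrite edgeC.
have nzx : z != x by rewrite eq_sym.
have [|sz] := side z x az ax nzx zx; first by constructor 1.
case: sx => sx; case: sy => sy.
- by constructor 2; apply: lefts sx sy nxy xy.
- by case: sz => sz; [constructor 2; apply: lefts sx sz nxz xz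
                     | constructor 3; apply: rights sy sz nyz yz].
- by case: sz => sz; [constructor 2; apply: lefts sy sz nyz yz
                     | constructor 3; apply: rights sx sz nxz xz].
- by constructor 3; apply: rights sx sy nxy xy.
Qed.

(* [t] and [u] are nonadjacent, else [a u c d] is a path in the neighbourhood of
   [t]; then [a] with leaves [b], [u] and the path [t d] is a chair. *)
Lemma opp_opp_skip a b c d e t u : pentagon a b c d e ->
  opp_type a b c d e t -> opp_type c d e a b u -> False.
Proof.
move=> P ot ou.
have bu : b != u.
  by apply: contraTneq ou => <-; move: P; rewrite /pentagon /opp_type;
     orient_pentagon a b c d e; decide_edges.
have := @gem_freeP G t a u c d gemF; have := @chair_freeP G a b u t d chairF bu.
move: P ot ou; rewrite /pentagon /opp_type.
orient_pentagon a b c d e; orient_from t a b c d e; orient_from u a b c d e.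
orient t u; by decide_edges.
Qed.

(* The claw at [c] consists of [b] and a pair [y], [p] not adjacent to [u];
   extending it by the edge from [b] to [u] gives a chair. *)
Lemma pentagon_opp_opp a b c d e : pentagon a b c d e -> claw c ->
  (exists t, opp_type a b c d e t) -> (exists u, opp_type b c d e a u) -> False.
Proof.
move=> P cl [t ot] [u ou].
have P3 := pentagon_rot (pentagon_rot P).
case: (claw_pentagon P3 cl) => [[v ov]|[y [p [oy pE yp nyp]]]|[y [p [oy _ _ _]]]].
- exact: opp_opp_skip P ot ov.
- have := @gem_freeP G d c p u e gemF; have := @gem_freeP G d c y u e gemF.
  have := @chair_freeP G c y p b u chairF nyp.
  move: P ot ou oy pE yp; rewrite /pentagon /opp_type.
  orient_pentagon a b c d e; orient_from y a b c d e; orient_from u a b c d e.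
  orient_from p a b c d e; orient y p; orient u p; orient u y; by decide_edges.
- apply: (@opp_opp_skip e a b c d y u); first by do 4!apply: pentagon_rot.
    by move: oy; rewrite /opp_type; decide_edges.
  exact: ou.
Qed.

(** The claw at [b] yields a further opposite vertex, at [b], [e] or [d]. The first two positions
    are next to [a], the third is two steps away, and both situations are already excluded. *)
Lemma pentagon_opp a b c d e : pentagon a b c d e ->
  claw b -> claw c -> claw d -> (exists t, opp_type a b c d e t) -> False.
Proof.
move=> P cb cc cd [t ot]; have P2 := pentagon_rot P.
case: (claw_pentagon P2 cb) => [ob|[y [_ [oy _ _ _]]]|[y [_ [oy _ _ _]]]].
- by apply: (pentagon_opp_opp P cc) => //; exists t.
- have Pr := pentagon_rev P.
  apply: (pentagon_opp_opp Pr cd).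
    by exists t; move: ot; rewrite /opp_type; decide_edges.
  by exists y; move: oy; rewrite /opp_type; decide_edges.
- apply: (@opp_opp_skip d e a b c y t) => //; first by do 3!apply: pentagon_rot.
  by move: oy; rewrite /opp_type; decide_edges.
Qed.

(** The claw at [a] yields an opposite vertex at [a], [d] or [c]; a rotation brings it to the first
    position of [pentagon_opp]. *)
Lemma pentagon_claw_free a b c d e : pentagon a b c d e ->
  claw a -> claw b -> claw c -> claw d -> claw e -> False.
Proof.
move=> P ca cb cc cd ce.
case: (claw_pentagon P ca) => [oa|[y [_ [oy _ _ _]]]|[y [_ [oy _ _ _]]]].
- exact: pentagon_opp P cb cc cd oa.
- apply: (@pentagon_opp d e a b c) => //; first by do 3!apply: pentagon_rot.
  by exists y.
- apply: (@pentagon_opp c d e a b) => //; first by do 2!apply: pentagon_rot.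
  by exists y; move: oy; rewrite /opp_type; decide_edges.
Qed.

End Pentagon.

(** * Layers of a critical set around a largest claw *)

Section Critical.
Variables (G : sgraph) (w : nat) (A : {set G}).
Hypotheses (chairF : free Chair G) (gemF : free P4_plus_K1 G).
Hypotheses (bw : clique_bound w [set: G]) (critA : critical A (2 * w - 1)).
Implicit Types (a b c d p q r s t u v x y : G) (S : {set G}).

Lemma critical_no_pentagon a b c d e :
  a \in A -> b \in A -> c \in A -> d \in A -> e \in A ->
  ~~ pentagon a b c d e.
Proof.
have clawA v : v \in A -> claw v.
  move=> vA; have [S [/subsetP sSN /stableP sS]] := critical_claw gemF bw critA vA.
  case/card_gt2P=> x [y [z [[xS yS zS] [nxy nyz nzx]]]].
  have nb s : s \in S -> v -- s by move=> /sSN; rewrite inE => /andP[].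
  exists x, y, z; rewrite (eq_sym x z).
  by split; [split; apply: nb | split; split=> //; apply: sS].
move=> aA bA cA dA eA; apply/negP => P.
by apply: (pentagon_claw_free chairF gemF P); apply: clawA.
Qed.

(* A co-component [Q] of the set of these common neighbours of [b] and [c] is
   homogeneous: a vertex of [A] that separates two nonadjacent elements of [Q]
   creates a chair, a gem or a pentagon through [a b c d]. *)
Lemma common_nbrs_clique a b c d x y :
  a \in A -> b \in A -> c \in A -> d \in A -> x \in A -> y \in A ->
  [&& a -- b, b -- c, c -- d, ~~ (a -- c), ~~ (a -- d) & ~~ (b -- d)] ->
  [&& b -- x, c -- x, ~~ (a -- x) & ~~ (d -- x)] ->
  [&& b -- y, c -- y, ~~ (a -- y) & ~~ (d -- y)] ->
  x != y -> x -- y.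
Proof.
move=> aA bA cA dA xA yA P4 Wx Wy nxy; apply: contraT => xy.
pose W := [set z in A | [&& b -- z, c -- z, ~~ (a -- z) & ~~ (d -- z)]].
pose r := [rel p q | [&& p \in W, q \in W, p != q & ~~ (p -- q)]].
pose Q := [set z | connect r x z].
have xW : x \in W by rewrite inE xA.
have yW : y \in W by rewrite inE yA.
have rQ p q : p \in Q -> r p q -> q \in Q.
  by move=> + rpq; rewrite !inE => xp; apply: connect_trans xp (@connect1 _ r _ _ rpq).
have xQ : x \in Q by rewrite inE connect0.
have yQ : y \in Q by apply: rQ xQ _; rewrite /= xW yW nxy.
have QW p : p \in Q -> p \in W.
  rewrite inE => /connectP[s]; case/lastP: s => [|s q] /=; first by move=> _ ->.
  by rewrite rcons_path last_rcons => /andP[_ /and4P[_ qW _ _]] ->.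
have r_sym : symmetric r.
  move=> p q; rewrite /= (eq_sym q) (edgeC q).
  by case: (p \in W); case: (q \in W).
have sepQ u p q : u \in A -> u \notin Q -> p \in Q -> r p q -> u -- p -> u -- q.
  move=> uA uQ pQ rpq up; have qQ := rQ p q pQ rpq; apply: contraT => uq.
  have uW : u \notin W.
    apply: contra uQ => uW; apply: (rQ q u qQ); apply/and4P.
    split; [exact: QW | exact: uW | | by rewrite edgeC].
    by apply: contraTneq up => <-; rewrite edgeC; case/and4P: rpq.
  have npent := critical_no_pentagon uA aA bA cA dA.
  have := QW p pQ; have := QW q qQ; rewrite !inE => /andP[_ Wq] /andP[_ Wp].
  have naq : a != q.
    by apply: contraTneq Wq => <-; move: P4; orient a c; decide_edges.
  have ndq : d != q.
    by apply: contraTneq Wq => <-; move: P4; orient b d; decide_edges.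
  have := @gem_freeP G b u p c q gemF; have := @gem_freeP G c u p b q gemF.
  have := @gem_freeP G b a u c q gemF; have := @gem_freeP G c d u b q gemF.
  have := @chair_freeP G b a q p u chairF naq.
  have := @chair_freeP G c d q p u chairF ndq.
  have {rpq} : ~~ (p -- q) by case/and4P: rpq.
  move: npent uW up uq P4 Wp Wq; rewrite inE uA /pentagon /=.
  orient a b; orient a c; orient a d; orient b c; orient b d; orient c d.
  orient u a; orient u b; orient u c; orient u d; orient u p; orient u q.
  orient p a; orient p b; orient p c; orient p d; orient p q.
  orient q a; orient q b; orient q c; orient q d.
  by decide_edges.
have sepQ' u p q : u \in A -> u \notin Q -> p \in Q -> connect r p q ->
    u -- p -> u -- q.
  move=> uA uQ + /connectP[s]; elim: s p => [|z s IHs] p pQ /=; first by move=> _ ->.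
  case/andP=> rpz rs lq up; have zQ := rQ p z pQ rpz.
  by apply: (IHs z zQ rs lq); apply: sepQ up.
(* [Q] lies in the neighbourhood of [b], hence is P4-free; homogeneity makes it a clique, against
   the nonadjacent pair [x], [y]. *)
have cQ : clique Q.
  apply: (critical_homogeneous critA).
  - by apply/subsetP => z /QW; rewrite inE => /andP[].
  - apply: P4_freeS (@nbhd_P4_free G A b gemF).
    by apply/subsetP => z /QW; rewrite !inE => /and3P[-> ->].
  move=> u uA uQ p q pQ qQ; apply: sepQ' => //.
  by rewrite !inE in pQ qQ; apply: connect_trans qQ; rewrite sym_connect_sym.
by move/cliqueP: cQ => /(_ x y xQ yQ nxy); rewrite (negPf xy).
Qed.

(** * Distance layers around the centre of a largest claw *)

Variables (v : G) (S : {set G}).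
Hypotheses (vA : v \in A) (sSN : S \subset nbhd A v) (sS : stable S).
Hypotheses (S3 : 3 <= #|S|).
Hypothesis maxS : forall u (I : {set G}),
  u \in A -> I \subset nbhd A u -> stable I -> #|I| <= #|S|.

(** If [x] missed both [s] and [t], chairs at [v] would show first that [x] misses all of [S], then
    that [r] misses at most one vertex of [S]. *)
Lemma max_claw_dist2 r x s t : r \in nbhd A v -> x \in A -> r -- x ->
  ~~ (v -- x) -> s \in S -> t \in S -> s != t -> ~~ (x -- s) -> x -- t.
Proof.
rewrite inE => /andP[rA vr] xA rx vx sS' tS nst xs.
have SN u : u \in S -> u \in A /\ v -- u.
  by move/(subsetP sSN); rewrite inE => /andP.
have Sst p q : p \in S -> q \in S -> ~~ (p -- q) by move/stableP: sS; apply.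
apply: contraT => xt.
have xS u : u \in S -> ~~ (x -- u).
  move=> uS; apply/negP => xu; have := @chair_freeP G v s t u x chairF nst.
  have [[[_ vs] [_ vt]] [_ vu]] := (SN s sS', SN t tS, SN u uS).
  rewrite vs vt vu (edgeC u x) xu (Sst s t) // (Sst s u) // (Sst t u) //.
  rewrite (edgeC s x) xs (edgeC t x) xt.
  by rewrite vx.
have r_misses p q : p \in S -> q \in S -> p != q -> ~~ (r -- p) -> r -- q.
  move=> pS qS npq rp; apply: contraT => rq.
  have := @chair_freeP G v p q r x chairF npq.
  have [[_ vp] [_ vq]] := (SN p pS, SN q qS).
  rewrite vp vq vr rx Sst //= (edgeC p r) rp (edgeC q r) rq.
  by rewrite (edgeC p x) xS // (edgeC q x) xS // vx.
have xNS : x \notin S by apply/negP => /SN[_]; rewrite (negPf vx).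
(* Otherwise [x] and [S] together form a larger stable set in the neighbourhood of [r]. *)
have [s1 s1S rs1] : exists2 s1, s1 \in S & ~~ (r -- s1).
  apply/exists_inP; apply: contraT; rewrite negb_exists_in => /forall_inP rS.
  have := @maxS r (x |: S) rA; rewrite cardsU1 xNS ltnn; apply.
    rewrite subUset sub1set inE xA rx /=; apply/subsetP => u uS.
    by rewrite inE (SN u uS).1; apply: negbNE; apply: rS.
  by apply: stableU1 => // u uS; apply: xS.
have /card_gt1P[p [q [pS qS npq]]] : 1 < #|S :\ s1|.
  by move: S3; rewrite (cardsD1 s1 S) s1S.
move: pS qS; rewrite !inE => /andP[ps1 pS] /andP[qs1 qS].
have rp : r -- p by apply: r_misses rs1; rewrite // eq_sym.
have rq : r -- q by apply: r_misses rs1; rewrite // eq_sym.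
have [[[s1A vs1] [pA vp]] [qA vq]] := (SN s1 s1S, SN p pS, SN q qS).
(* [s1 v r x] is an induced path of which [p] and [q] see exactly the two middle vertices, so they
   would be adjacent. *)
have := @common_nbrs_clique s1 v r x p q s1A vA rA xA pA qA.
rewrite (negPf (Sst p q pS qS)); apply=> //.
- by rewrite (edgeC s1 v) vs1 vr rx (edgeC s1 r) rs1 (edgeC s1 x) xS.
- by rewrite vp rp Sst // xS.
- by rewrite vq rq Sst // xS.
Qed.

Definition dist2 :=
  [set x in A | [&& x != v, ~~ (v -- x) & [exists r in nbhd A v, r -- x]]].

Definition dist3 := [set x in A | [&& x != v, ~~ (v -- x),
  ~~ [exists r in nbhd A v, r -- x] & [exists r in dist2, r -- x]]].

Lemma dist2_misses_one x s t : x \in dist2 -> s \in S -> t \in S -> s != t ->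
  (x -- s) || (x -- t).
Proof.
rewrite inE => /andP[xA /and3P[_ vx /exists_inP[r rN rx]]] sS' tS nst.
by apply/orP; have [|xs] := boolP (x -- s); [left | right; apply: (max_claw_dist2 rN) xs].
Qed.

(* Otherwise [v t x y s] is a pentagon. *)
Lemma dist2_edge_misses x y s t : x \in dist2 -> y \in dist2 -> x -- y ->
  s \in S -> t \in S -> s != t -> (x -- s) || (y -- t).
Proof.
move=> xD yD xy sS' tS nst.
have xst := dist2_misses_one xD sS' tS nst; have yst := dist2_misses_one yD sS' tS nst.
have /andP[sA vs] : (s \in A) && (v -- s) by move/(subsetP sSN): sS'; rewrite inE.
have /andP[tA vt] : (t \in A) && (v -- t) by move/(subsetP sSN): tS; rewrite inE.
have /negPf st : ~~ (s -- t) by move/stableP: sS; apply.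
move: xD yD; rewrite !inE => /andP[xA /and3P[_ vx _]] /andP[yA /and3P[_ vy _]].
have := critical_no_pentagon vA tA xA yA sA.
move: xst yst vs vt st vx vy xy; rewrite /pentagon.
orient v s; orient v t; orient v x; orient v y; orient x s; orient x t.
orient y s; orient y t; orient x y; orient s t.
by decide_edges.
Qed.

(** Adjacent vertices of [dist2] cannot miss different elements of [S], and a P4 has no stable
    triple, so the vertices of a P4 in [dist2] miss at most two of [r], [s], [t] altogether; a
    remaining one is the centre of a gem. As [v] has no neighbour in [dist2], it lies on no such
    path. *)
Lemma P4_free_dist2 : P4_free (v |: dist2).
Proof.
have vD x : x \in dist2 -> ~~ (v -- x) by rewrite inE => /and4P[].
have inD x y : x \in v |: dist2 -> y \in v |: dist2 -> x -- y -> x \in dist2.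
  case/setU1P=> [->|//] /setU1P[->|/vD/negPf->//]; by rewrite edgexx.
move=> a b c d aU bU cU dU; apply/negP => P4.
have [ab bc cd] : [/\ a -- b, b -- c & c -- d] by case/and4P: P4.
have {aU} aD := inD a b aU bU ab; have bD := inD b c bU cU bc.
have {bU} cD := inD c d cU dU cd.
have {inD cU} dD : d \in dist2 by apply: (inD d c); rewrite // edgeC.
have /card_gt2P[r [s [t [[rS sS' tS] [nrs nst ntr]]]]] : 2 < #|S| by [].
have nrt : r != t by rewrite eq_sym.
have one x p q (xD : x \in dist2) := @dist2_misses_one x p q xD.
have edge x y p q (xy : x -- y) (xD : x \in dist2) (yD : y \in dist2)
  (pS : p \in S) (qS : q \in S) (npq : p != q) :
  [&& (x -- p) || (x -- q), (y -- p) || (y -- q), (x -- p) || (y -- q)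
     & (x -- q) || (y -- p)].
  rewrite !one //= dist2_edge_misses //=.
  by rewrite orbC dist2_edge_misses // edgeC.
have := @gem_freeP G r a b c d gemF; have := @gem_freeP G s a b c d gemF.
have := @gem_freeP G t a b c d gemF.
have := edge a b r s ab aD bD rS sS' nrs; have := edge a b r t ab aD bD rS tS nrt.
have := edge a b s t ab aD bD sS' tS nst.
have := edge b c r s bc bD cD rS sS' nrs; have := edge b c r t bc bD cD rS tS nrt.
have := edge b c s t bc bD cD sS' tS nst.
have := edge c d r s cd cD dD rS sS' nrs; have := edge c d r t cd cD dD rS tS nrt.
have := edge c d s t cd cD dD sS' tS nst.
move: P4 {ab bc cd}; orient a r; orient a s; orient a t; orient b r; orient b s.
orient b t; orient c r; orient c s; orient c t; orient d r; orient d s; orient d t.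
by decide_edges.
Qed.

(** [x] sees two vertices [p], [q] of [S], while [y] and [u] see none. If [x] missed [u], then [p],
    [q] and the arm [y u] would form a chair at [x]. *)
Lemma dist3_nbr x y u : x \in dist2 -> y \in dist3 -> u \in A -> u \notin dist2 ->
  u != v -> ~~ (v -- u) -> x -- y -> y -- u -> x -- u.
Proof.
move=> xD; rewrite inE => /andP[yA /and4P[_ vy nNy _]] uA uD uv vu xy yu.
have nNu : ~~ [exists r in nbhd A v, r -- u].
  by apply: contra uD => Nu; rewrite inE uA uv vu.
have far z s : ~~ [exists r in nbhd A v, r -- z] -> s \in S -> ~~ (s -- z).
  by move=> /exists_inPn nz /(subsetP sSN); apply: nz.
have /card_gt2P[r [s [t [[rS sS' tS] [nrs nst ntr]]]]] : 2 < #|S| by [].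
have Sst p q : p \in S -> q \in S -> ~~ (p -- q) by move/stableP: sS; apply.
suff [p [q [pS qS npq xp xq]]] :
    exists p q, [/\ p \in S, q \in S, p != q, x -- p & x -- q].
  apply: contraT => xu; have := @chair_freeP G x p q y u chairF npq.
  by rewrite xp xq xy yu Sst // (far y p) // (far y q) // (far u p) // (far u q) // xu.
have := dist2_misses_one xD rS sS' nrs; have := dist2_misses_one xD sS' tS nst.
have := dist2_misses_one xD tS rS ntr.
have [xr|_] := boolP (x -- r); have [xs|_] := boolP (x -- s);
  have [xt|_] := boolP (x -- t) => //= _ _ _.
- by exists r, s.
- by exists r, s.
- by exists t, r.
- by exists s, t.
Qed.

Lemma nbhd_dist3_sep x y : x \in nbhd A v -> y \in dist3 -> ~~ (x -- y).
Proof.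
move=> xN; rewrite inE => /andP[_ /and4P[_ _ nNy _]].
by apply: contra nNy => xy; apply/exists_inP; exists x.
Qed.

Lemma dist3_closed x y u : x \in dist2 -> y \in dist3 ->
  u \in nbhd A v :|: dist3 -> x -- y -> y -- u -> u \in dist3 /\ x -- u.
Proof.
move=> xD yD /setUP[uN|uD] xy yu.
  by have := nbhd_dist3_sep uN yD; rewrite edgeC yu.
split=> //; apply: dist3_nbr xy yu => //; move: uD; rewrite !inE.
- by case/andP.
- by case/andP=> -> /and4P[-> -> /negPf-> _].
- by case/and3P.
- by case/and4P.
Qed.

Lemma dist3_parent y : y \in dist3 -> exists2 x, x \in dist2 & x -- y.
Proof. by rewrite inE => /andP[_ /and4P[_ _ _ /exists_inP]]. Qed.

(** No edge joins the two parts. A path in [dist3] lies, vertex after vertex, in the neighbourhood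
    of a parent of its first vertex, which gives a gem. *)
Lemma P4_free_nbhd_dist3 : P4_free (nbhd A v :|: dist3).
Proof.
move=> a b c d aU bU cU dU; apply/negP => P4.
have [ab bc cd] : [/\ a -- b, b -- c & c -- d] by case/and4P: P4.
have [aD|aD] := boolP (a \in dist3).
  have [x xD xa] := dist3_parent aD.
  have [bD xb] := dist3_closed xD aD bU xa ab.
  have [cD xc] := dist3_closed xD bD cU xb bc.
  have [_ xd] := dist3_closed xD cD dU xc cd.
  by have := @gem_freeP G x a b c d gemF; rewrite xa xb xc xd /= P4.
have stay y u : y \in nbhd A v -> u \in nbhd A v :|: dist3 -> y -- u -> u \in nbhd A v.
  by move=> yN /setUP[//|uD]; rewrite (negPf (nbhd_dist3_sep yN uD)).
have aN : a \in nbhd A v by case/setUP: aU => //; rewrite (negPf aD).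
have bN := stay a b aN bU ab; have cN := stay b c bN cU bc.
have dN := stay c d cN dU cd.
by have := @nbhd_P4_free G A v gemF a b c d aN bN cN dN; rewrite P4.
Qed.

(** A clique meeting [dist3] lies in the neighbourhood of a vertex of [dist2], any other in that of
    [v]. *)
Lemma clique_bound_nbhd_dist3 : clique_bound w.-1 (nbhd A v :|: dist3).
Proof.
move=> K /subsetP sK cK; have [/existsP[y /andP[yK yD]]|noD] :=
  boolP [exists y, (y \in K) && (y \in dist3)].
  have [x xD xy] := dist3_parent yD.
  apply: (@clique_bound_nbhd G w x K bw) => // u uK.
  have [->//|nuy] := eqVneq u y.
  apply: (dist3_closed xD yD (sK u uK) xy _).2.
  by apply: (cliqueP _ cK); rewrite // eq_sym.
apply: (@clique_bound_nbhd G w v K bw) => // u uK.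
case/setUP: (sK u uK) => [|uD]; first by rewrite inE => /andP[].
by case/existsP: noD; exists u; rewrite uK.
Qed.

(** A neighbour beyond [dist3] would be adjacent to a parent in [dist2], so no edge joins [B] to the
    rest of [A]. Criticality colours that rest, and the same colours serve for [B]. *)
Lemma critical_max_claw_false : False.
Proof.
pose B := (nbhd A v :|: dist3) :|: (v |: dist2).
have sBA : B \subset A.
  by apply/subsetP => x /setUP[/setUP[]|/setU1P[->//|]]; rewrite inE => /andP[].
have colB : colorable_on B (2 * w - 1).
  (* With truncated subtraction this also holds when [w] is 0. *)
  have -> : 2 * w - 1 = w.-1 + w.
    by case: (w) => // n; rewrite mul2n -addnn addSn subn1.
  apply: colorable_onU; apply: P4_free_colorable.
  - exact: P4_free_nbhd_dist3.
  - exact: clique_bound_nbhd_dist3.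
  - exact: P4_free_dist2.
  - exact: clique_boundS (subsetT _) bw.
have colD : colorable_on (A :\: B) (2 * w - 1).
  apply: (critical_proper critA); apply/properP; split; first exact: subsetDl.
  by exists v; rewrite ?vA // !inE eqxx orbT.
have := critical_not_colorable critA.
rewrite -(setID A B) (setIidPr sBA) colorable_onU_sep // => x u xB.
case/setDP=> uA; rewrite /B !in_setU in_set1 !negb_or => /andP[/andP[uN uD3] /andP[uv uD2]].
have vu : ~~ (v -- u) by move: uN; rewrite inE uA.
apply/negP => xu.
have uNN : ~~ [exists r in nbhd A v, r -- u].
  by apply: contra uD2 => h; rewrite inE uA uv vu.
have uD : ~~ [exists r in dist2, r -- u].
  by apply: contra uD3 => h; rewrite inE uA uv vu uNN.
case/setUP: xB => [/setUP[xN|xD]|/setU1P[xv|xD]].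
- by case/exists_inP: uNN; exists x.
- have [y yD yx] := dist3_parent xD.
  by case/exists_inP: uD; exists y => //; apply: dist3_nbr xu.
- by rewrite -xv xu in vu.
- by case/exists_inP: uD; exists x.
Qed.

End Critical.

(** * The chromatic bound *)

Lemma chair_gem_free_colorable (G : sgraph) (w : nat) (A : {set G}) :
  free Chair G -> free P4_plus_K1 G -> clique_bound w [set: G] ->
  colorable_on A (2 * w - 1).
Proof.
move=> chairF gemF bw; apply: contraT => nA.
have [B critB _] := minset_exists (P := fun B => ~~ colorable_on B (2 * w - 1)) nA.
have [v vB] : exists v, v \in B.
  apply/set0Pn; apply: contraFneq (critical_not_colorable critB).
  exact: colorable_on0.
pose P (c : G * {set G}) :=
  [&& c.1 \in B, c.2 \subset nbhd B c.1 & stable c.2].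
have [S [sSN sS S3]] := critical_claw gemF bw critB vB.
have P0 : P (v, S) by rewrite /P /= vB sSN.
(* The maximum runs over all vertices of [B] and all stable subsets of their neighbourhoods; the
   starting pair, from a claw, makes it at least three. *)
case: (@arg_maxnP _ (v, S) P (fun c => #|c.2|) P0) => -[u I] /and3P[/= uB sIN sI] maxI.
case: (critical_max_claw_false chairF gemF bw critB uB sIN sI).
  exact: leq_trans S3 (maxI (v, S) P0).
by move=> t J tB sJN sJ; apply: (maxI (t, J)); apply/and3P.
Qed.

Theorem theorem1 (G : sgraph) (hChair : free Chair G)
    (hGem : free P4_plus_K1 G) :
  chromatic_number G <= 2 * clique_number G - 1.
Proof.
have bw : clique_bound (clique_number G) [set: G].
  by move=> K _ cK; apply: leq_bigmax_cond.
have /colorable_onP[f [fk fG]] := chair_gem_free_colorable [set: G] hChair hGem bw.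
rewrite /chromatic_number; case: ex_minnP => m _; apply.
apply/existsP; exists [ffun x => Ordinal (fk x (in_setT x))].
apply/forallP => x; apply/forallP => y; apply/implyP => xy.
by rewrite !ffunE -val_eqE /=; apply: fG.
Qed.
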